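(* Let $G$ be the undirected graph whose vertex set is the set of positive integers, in which distinct vertices $n$ and $m$ are joined by an edge if $m$ can be obtained from $n$ by one Choix de Bruxelles operation. Then $G$ has exactly two connected components: one consists of all positive integers whose decimal expansion does not end in $0$ or $5$, and the other consists of all positive integers whose decimal expansion ends in $0$ or $5$.
   Context: The Choix de Bruxelles operation: given a positive integer $n$ with decimal expansion $d_1 d_2 \ldots d_k$, choose indices $1 \le p \le q \le k$ with $d_p \neq 0$, let $s$ be the number with decimal representation $d_p d_{p+1}\ldots d_q$, and replace this substring in situ by the decimal expansion of $2s$, or, if $s$ is even, by the decimal expansion of $s/2$. One may also leave $n$ unchanged (empty substring). The operation is symmetric: if $n$ can be changed to $m$ then $m$ can be changed to $n$. *)

(* Defs.v *)
From HB Require Import structures.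
From Stdlib Require Import Relation_Operators.
From mathcomp Require Import all_boot zify.
From mathcomp Require Import boolp classical_sets.

Set Implicit Arguments.
Unset Strict Implicit.
Unset Printing Implicit Defensive.

Local Open Scope nat_scope.

Record ugraph (V : Type) := UGraph {
  adj :> V -> V -> Prop;
  adj_irrefl : forall x, ~ adj x x;
  adj_sym : forall x y, adj x y -> adj y x }.

Definition reachable (V : Type) (G : ugraph V) (x y : V) : Prop :=
  clos_refl_trans V G x y.

Definition components (V : Type) (G : ugraph V) : set (set V) :=
  [set C | exists x : V, C = [set y | reachable G x y]]%classic.

(* Decimal expansions are written most significant digit first; the first
   argument of [digits_rec] is fuel. *)
Fixpoint digits_rec (k n : nat) : seq nat :=
  if k is k'.+1 then
    if n < 10 then [:: n] else rcons (digits_rec k' (n %/ 10)) (n %% 10)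
  else [::].

Definition digits (n : nat) : seq nat := digits_rec n.+1 n.

Definition of_digits (d : seq nat) : nat := foldl (fun a c => 10 * a + c) 0 d.

(* d_p ... d_q, with 1-based indices and d = d_1 ... d_k *)
Definition substring (p q : nat) (d : seq nat) : seq nat :=
  take (q - p.-1) (drop p.-1 d).

Definition replace (p q : nat) (d t : seq nat) : seq nat :=
  take p.-1 d ++ t ++ drop q d.

(* m is obtained from n by one Choix de Bruxelles operation *)
Definition choix (n m : nat) : Prop :=
  m = n \/
  exists p q : nat,
    let d := digits n in
    let s := of_digits (substring p q d) in
    [/\ 1 <= p, p <= q, q <= size d, nth 0 d p.-1 != 0
      & m = of_digits (replace p q d (digits (2 * s))) \/
        (2 %| s /\ m = of_digits (replace p q d (digits (s %/ 2))))].

Lemma digits_rec_fuel k n : n < k -> digits_rec k n = digits n.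
Proof.
suff H : forall l, n < k -> n < l -> digits_rec k n = digits_rec l n.
  by move=> nk; apply: H.
elim: k n => [|k IH] n [|l] //= nk nl; case: ltnP => // n10.
by congr rcons; apply: IH; lia.
Qed.

Lemma digitsE n :
  digits n = if n < 10 then [:: n] else rcons (digits (n %/ 10)) (n %% 10).
Proof.
rewrite {1}/digits /=; case: ltnP => // n10; congr rcons.
by apply: digits_rec_fuel; lia.
Qed.

Lemma of_digits_rcons d c : of_digits (rcons d c) = 10 * of_digits d + c.
Proof. by rewrite /of_digits foldl_rcons. Qed.

Lemma digitsK n : of_digits (digits n) = n.
Proof.
elim/ltn_ind: n => n IH; rewrite digitsE; case: ltnP => n10.
  by rewrite /of_digits /=; lia.
by rewrite of_digits_rcons IH; lia.
Qed.

Definition expansion (d : seq nat) : bool :=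
  (head 0 d != 0) && all (fun c => c < 10) d.

Lemma of_digits_gt0 d : head 0 d != 0 -> 0 < of_digits d.
Proof.
elim/last_ind: d => // d c IH; rewrite of_digits_rcons.
case: d IH => [|a d] IH /= h; first by rewrite /of_digits /=; lia.
by have := IH h; lia.
Qed.

Lemma of_digitsK d : expansion d -> digits (of_digits d) = d.
Proof.
elim/last_ind: d => // d c IH /andP[h]; rewrite all_rcons => /andP[c10 ad].
rewrite of_digits_rcons digitsE; case: d IH h ad => [|a d] IH h ad.
  by rewrite /of_digits /= muln0 add0n c10.
have p := @of_digits_gt0 (a :: d) h.
rewrite ifF; last by lia.
rewrite -[in RHS]IH; last by apply/andP.
by congr (rcons (digits _) _); lia.
Qed.

Lemma expansion_digits n : 0 < n -> expansion (digits n).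
Proof.
elim/ltn_ind: n => n IH n0; rewrite digitsE; case: ltnP => n10.
  by rewrite /expansion /= n10 -lt0n n0.
have /andP[h a] : expansion (digits (n %/ 10)) by apply: IH; lia.
rewrite /expansion all_rcons a andbT; apply/andP; split; last by lia.
by case: (digits _) h.
Qed.

Lemma choix_splitP n m : 0 < n ->
  choix n m <-> m = n \/ exists u w v : seq nat,
    [/\ digits n = u ++ w ++ v, head 0 w != 0
      & m = of_digits (u ++ digits (2 * of_digits w) ++ v) \/
        (2 %| of_digits w /\
         m = of_digits (u ++ digits (of_digits w %/ 2) ++ v))].
Proof.
move=> n0; split=> -[->|]; [by left| |by left|].
  move=> [p [q [p1 pq qk hp hm]]]; right.
  exists (take p.-1 (digits n)), (substring p q (digits n)),
    (drop q (digits n)); split=> //.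
    rewrite /substring -[in LHS](cat_take_drop p.-1 (digits n)).
    congr (_ ++ _).
    rewrite -[in LHS](cat_take_drop (q - p.-1) (drop p.-1 (digits n))).
    by rewrite drop_drop; congr (_ ++ drop _ _); lia.
  rewrite -nth0 /substring nth_take ?nth_drop ?addn0 //; lia.
move=> [u [w [v [dE hw hm]]]]; right.
have w0 : 0 < size w by case: w hw {dE hm}.
exists (size u).+1, (size u + size w).
have tE : take (size u) (digits n) = u by rewrite dE take_size_cat.
have rE : drop (size u + size w) (digits n) = v.
  by rewrite dE catA drop_size_cat // size_cat.
have sE : substring (size u).+1 (size u + size w) (digits n) = w.
  by rewrite /substring /= dE drop_size_cat // addKn take_size_cat.
rewrite /= sE /replace /= tE rE; split=> //.
- by lia.
- by rewrite dE !size_cat; lia.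
- rewrite dE nth_cat ltnn subnn nth_cat w0 nth0 //.
Qed.

Lemma expansion_subst u w v t : expansion (u ++ w ++ v) -> head 0 w != 0 ->
  expansion t -> expansion (u ++ t ++ v) /\ expansion w.
Proof.
rewrite /expansion !all_cat => /and4P[h au aw av] hw /andP[ht at_].
rewrite au aw av hw at_ /=; split=> //; rewrite andbT.
by case: u h {au} => //= _; case: t ht {at_}.
Qed.

Lemma choix_sym n m : 0 < n -> 0 < m -> choix n m -> choix m n.
Proof.
move=> n0 m0 /(choix_splitP _ n0) [->|]; first by left.
move=> [u [w [v [dE hw hm]]]]; apply/(choix_splitP _ m0); right.
have en := expansion_digits n0; rewrite dE in en.
have s0 := of_digits_gt0 hw.
have key t : 0 < t -> m = of_digits (u ++ digits t ++ v) ->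
    [/\ digits m = u ++ digits t ++ v, head 0 (digits t) != 0
      & digits (of_digits w) = w].
  move=> t0 ->; have et := expansion_digits t0.
  have [em ew] := expansion_subst en hw et.
  by split; [exact: of_digitsK|case/andP: et|exact: of_digitsK].
have nE : n = of_digits (u ++ w ++ v) by rewrite -dE digitsK.
case: hm => [|[ev]] hm.
  have [|dm ht wE] := key _ _ hm; first by lia.
  exists u, (digits (2 * of_digits w)), v; split=> //.
  by right; rewrite digitsK dvdn_mulr // mulKn // wE.
have [|dm ht wE] := key _ _ hm; first by lia.
exists u, (digits (of_digits w %/ 2)), v; split=> //.
by left; rewrite digitsK mulnC divnK // wE.
Qed.

Definition posint : Type := {n : nat | 0 < n}.

Definition choix_adj (n m : posint) : Prop :=
  n <> m /\ choix (val n) (val m).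

Lemma choix_adj_irrefl n : ~ choix_adj n n.
Proof. by case. Qed.

Lemma choix_adj_sym n m : choix_adj n m -> choix_adj m n.
Proof.
case=> nm c; split; first by move=> e; apply: nm.
by apply: choix_sym c; apply: valP.
Qed.

Definition choix_graph : ugraph posint :=
  UGraph choix_adj_irrefl choix_adj_sym.

Definition ends_in_0_or_5 (n : posint) : bool :=
  last 0 (digits (val n)) \in [:: 0; 5].

(* Main.v *)
(* Divisibility by 5 is invariant, since doubling and halving a final
   substring preserve it and any other substring leaves the last digit alone.
   For connectivity, the relation generated on digit strings by doubling a
   substring is a congruence for concatenation. Modulo this congruence every
   nonzero digit other than 5 is equivalent to 1, 5 ~ 10, 11 ~ 1, 101 ~ 1 and
   100 ~ 10; so, reading a number digit by digit from the left, every expansion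
   is equivalent to 1 or to 10. *)
Require Import Defs.
From Stdlib Require Import Relation_Operators.
From mathcomp Require Import all_boot zify.
From mathcomp Require Import boolp classical_sets.

Set Implicit Arguments.
Unset Strict Implicit.
Unset Printing Implicit Defensive.

Local Open Scope classical_set_scope.

(** * Divisibility by 5 as an invariant of the operation *)

Lemma of_digits_mod10 x : of_digits x = last 0 x %[mod 10].
Proof.
case/lastP: x => // x c.
by rewrite of_digits_rcons last_rcons mulnC modnMDl.
Qed.

Lemma dvd5_of_digits x : (5 %| of_digits x) = (5 %| last 0 x).
Proof. by have := of_digits_mod10 x; lia. Qed.

Lemma digits_neq_nil n : digits n != [::].
Proof. by rewrite digitsE; case: ifP => // _; case: (digits _). Qed.

(** Only the last digit matters: it lies in [v] if [v] is nonempty, and otherwise in the replaced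
    block, which must be nonempty lest it fall in [u]. *)
Lemma dvd5_subst u w t v : w != [::] -> t != [::] ->
  (5 %| of_digits w) = (5 %| of_digits t) ->
  (5 %| of_digits (u ++ w ++ v)) = (5 %| of_digits (u ++ t ++ v)).
Proof.
rewrite !dvd5_of_digits !last_cat.
by case/lastP: v => [|v c]; rewrite ?last_rcons //; case: w; case: t.
Qed.

Lemma dvd5_choix n m : 0 < n -> choix n m -> (5 %| n) = (5 %| m).
Proof.
move=> n0 /(choix_splitP _ n0)[->//|[u [w [v [dE hw hm]]]]].
rewrite -[n]digitsK dE.
have w0 : w != [::] by case: w hw {dE hm}.
by case: hm => [->|[ev ->]];
  apply: dvd5_subst => //; rewrite ?digits_neq_nil ?digitsK //; lia.
Qed.

Lemma ends_in_0_or_5E (n : posint) : ends_in_0_or_5 n = (5 %| val n).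
Proof.
rewrite /ends_in_0_or_5 -[in RHS](digitsK (val n)) dvd5_of_digits.
have /andP[_ /allP/(_ (last 0 (digits (val n))))] := expansion_digits (valP n).
case: (digits _) (digits_neq_nil (val n)) => //= c d _; rewrite mem_last !inE.
by move=> /(_ isT); lia.
Qed.

Lemma reachable_ends_in_0_or_5 a b :
  reachable choix_graph a b -> ends_in_0_or_5 a = ends_in_0_or_5 b.
Proof.
elim=> // [x y [_ xy]|x y z _ -> _ ->] //.
by rewrite !ends_in_0_or_5E; apply: dvd5_choix xy; exact: valP.
Qed.

(** * The congruence on digit strings generated by doubling *)

(** Halving is left to the symmetric closure. The whole string [x] may begin with 0, so that
    contexts can be added freely on either side. *)
Definition double_step (x y : seq nat) : Prop := exists u w v : seq nat,
  [/\ x = u ++ w ++ v, y = u ++ digits (2 * of_digits w) ++ v & expansion w].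

Definition str_equiv := clos_refl_sym_trans (seq nat) double_step.

Local Notation "x ~ y" := (str_equiv x y) (at level 70).

Lemma str_equiv_refl x : x ~ x.
Proof. exact: rst_refl. Qed.

Lemma str_equiv_sym x y : x ~ y -> y ~ x.
Proof. exact: rst_sym. Qed.

Lemma str_equiv_trans y x z : x ~ y -> y ~ z -> x ~ z.
Proof. exact: rst_trans. Qed.

Lemma str_equiv_cat u v x y : x ~ y -> u ++ x ++ v ~ u ++ y ++ v.
Proof.
elim=> [a b [u' [w [v' [-> -> ew]]]]|a|a b _ IH|a b c _ IH1 _ IH2].
- by apply: rst_step; exists (u ++ u'), w, (v' ++ v); rewrite -!catA.
- exact: str_equiv_refl.
- exact: str_equiv_sym.
- exact: str_equiv_trans IH2.
Qed.

Lemma str_equiv_rcons c x y : x ~ y -> rcons x c ~ rcons y c.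
Proof. by rewrite -!cats1 => /(str_equiv_cat [::] [:: c]). Qed.

Lemma str_equiv_double u w v y : expansion w ->
  u ++ digits (2 * of_digits w) ++ v ~ y -> u ++ w ++ v ~ y.
Proof. by move=> ew; apply/str_equiv_trans/rst_step; exists u, w, v. Qed.

(** For chaining moves on the left-hand string; [w] is the block after halving. *)
Lemma str_equiv_halve u w v y : expansion w ->
  u ++ w ++ v ~ y -> u ++ digits (2 * of_digits w) ++ v ~ y.
Proof.
by move=> ew; apply/str_equiv_trans/str_equiv_sym/rst_step; exists u, w, v.
Qed.

(** * Explicit chains for short strings *)

Lemma equiv2 : [:: 2] ~ [:: 1].
Proof.
apply: (@str_equiv_halve [::] [:: 1] [::]) => //.
exact: str_equiv_refl.
Qed.

Lemma equiv4 : [:: 4] ~ [:: 1].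
Proof.
apply: (@str_equiv_halve [::] [:: 2] [::]) => //.
exact: equiv2.
Qed.

Lemma equiv8 : [:: 8] ~ [:: 1].
Proof.
apply: (@str_equiv_halve [::] [:: 4] [::]) => //.
exact: equiv4.
Qed.

Lemma equiv16 : [:: 1; 6] ~ [:: 1].
Proof.
apply: (@str_equiv_halve [::] [:: 8] [::]) => //.
exact: equiv8.
Qed.

(* 12 -> 24 -> 28 -> 56 -> 112 -> 16 *)
Lemma equiv12 : [:: 1; 2] ~ [:: 1].
Proof.
apply: (@str_equiv_double [::] [:: 1; 2] [::]) => //.
apply: (@str_equiv_double [:: 2] [:: 4] [::]) => //.
apply: (@str_equiv_double [::] [:: 2; 8] [::]) => //.
apply: (@str_equiv_double [::] [:: 5; 6] [::]) => //.
apply: (@str_equiv_halve [:: 1] [:: 6] [::]) => //.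
exact: equiv16.
Qed.

Lemma equiv6 : [:: 6] ~ [:: 1].
Proof.
apply: (@str_equiv_double [::] [:: 6] [::]) => //.
exact: equiv12.
Qed.

Lemma equiv3 : [:: 3] ~ [:: 1].
Proof.
apply: (@str_equiv_double [::] [:: 3] [::]) => //.
exact: equiv6.
Qed.

Lemma equiv14 : [:: 1; 4] ~ [:: 1].
Proof.
apply: (@str_equiv_halve [:: 1] [:: 2] [::]) => //.
exact: equiv12.
Qed.

Lemma equiv7 : [:: 7] ~ [:: 1].
Proof.
apply: (@str_equiv_double [::] [:: 7] [::]) => //.
exact: equiv14.
Qed.

(** The chain is 9 -> 18 -> 14, where the second move doubles or halves only the final digit. *)
Lemma equiv9 : [:: 9] ~ [:: 1].
Proof.
apply: (@str_equiv_double [::] [:: 9] [::]) => //.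
apply: (@str_equiv_halve [:: 1] [:: 4] [::]) => //.
exact: equiv14.
Qed.

Lemma equiv5 : [:: 5] ~ [:: 1; 0].
Proof.
apply: (@str_equiv_double [::] [:: 5] [::]) => //.
exact: str_equiv_refl.
Qed.

Lemma equiv11 : [:: 1; 1] ~ [:: 1].
Proof.
apply: (@str_equiv_double [:: 1] [:: 1] [::]) => //.
exact: equiv12.
Qed.

(* 101 -> 102 -> 51 -> 52 -> 26 -> 13 -> 16 *)
Lemma equiv101 : [:: 1; 0; 1] ~ [:: 1].
Proof.
apply: (@str_equiv_double [:: 1; 0] [:: 1] [::]) => //.
apply: (@str_equiv_halve [::] [:: 5; 1] [::]) => //.
apply: (@str_equiv_double [:: 5] [:: 1] [::]) => //.
apply: (@str_equiv_halve [::] [:: 2; 6] [::]) => //.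
apply: (@str_equiv_halve [::] [:: 1; 3] [::]) => //.
apply: (@str_equiv_double [:: 1] [:: 3] [::]) => //.
exact: equiv16.
Qed.

Lemma equiv110 : [:: 1; 1; 0] ~ [:: 1; 0].
Proof. exact: (str_equiv_rcons 0 equiv11). Qed.

(* 100 -> 50 -> 25 -> 210 -> 110 *)
Lemma equiv100 : [:: 1; 0; 0] ~ [:: 1; 0].
Proof.
apply: (@str_equiv_halve [::] [:: 5; 0] [::]) => //.
apply: (@str_equiv_halve [::] [:: 2; 5] [::]) => //.
apply: (@str_equiv_double [:: 2] [:: 5] [::]) => //.
apply: (@str_equiv_halve [::] [:: 1] [:: 1; 0]) => //.
exact: equiv110.
Qed.

Lemma digit_equiv c : 0 < c < 10 -> [:: c] ~ [:: 1] \/ [:: c] ~ [:: 1; 0].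
Proof.
case: c => [|[|[|[|[|[|[|[|[|[|c]]]]]]]]]] // _; try by left; do
  [ exact: str_equiv_refl | exact: equiv2 | exact: equiv3 | exact: equiv4
  | exact: equiv6 | exact: equiv7 | exact: equiv8 | exact: equiv9 ].
by right; exact: equiv5.
Qed.

(** Induction on the last digit. With the prefix reduced to 1 or 10 and the new digit to 0, 1 or 10,
    only 10, 100, 11, 101, 110 and 1010 remain. *)
Lemma expansion_equiv x : expansion x -> x ~ [:: 1] \/ x ~ [:: 1; 0].
Proof.
elim/last_ind: x => // d c IH /andP[h]; rewrite all_rcons => /andP[c10 ad].
have [d0|d0] := eqVneq d [::].
  by move: h; rewrite d0 /= => h; apply: digit_equiv; lia.
have /IH ed : expansion d by rewrite /expansion ad andbT; case: d h d0 {IH ad}.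
have [c0|c0] := posnP c.
  right; rewrite c0; case: ed => /(str_equiv_rcons 0) // e.
  exact: str_equiv_trans equiv100.
have [ec|ec] : [:: c] ~ [:: 1] \/ [:: c] ~ [:: 1; 0].
- by apply: digit_equiv; rewrite c0.
- left; case: ed => /(str_equiv_rcons c)/str_equiv_trans; apply.
    exact: str_equiv_trans (str_equiv_cat [:: 1] [::] ec) equiv11.
  exact: str_equiv_trans (str_equiv_cat [:: 1; 0] [::] ec) equiv101.
- right; case: ed => /(str_equiv_rcons c)/str_equiv_trans; apply.
    exact: str_equiv_trans (str_equiv_cat [:: 1] [::] ec) equiv110.
  (* The string is now 1010, that is, 101 followed by 0. *)
  apply: str_equiv_trans (str_equiv_cat [:: 1; 0] [::] ec) _.
  exact: (str_equiv_rcons 0 equiv101).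
Qed.

(** * From equivalent strings to paths in the graph *)

Lemma reachable_trans (V : Type) (G : ugraph V) y x z :
  reachable G x y -> reachable G y z -> reachable G x z.
Proof. exact: rt_trans. Qed.

Lemma reachable_sym (V : Type) (G : ugraph V) x y :
  reachable G x y -> reachable G y x.
Proof.
elim=> [a b ab|a|a b c _ ba _ cb]; last exact: reachable_trans ba.
  by apply/rt_step/adj_sym.
exact: rt_refl.
Qed.

(** Both [w] and its double are expansions, so each may replace the other. Hence a chain starting at
    an expansion never acquires a leading 0. *)
Lemma double_step_expansion x y :
  double_step x y -> expansion x = expansion y.
Proof.
move=> [u [w [v [-> -> ew]]]].
have hw : head 0 w != 0 by case/andP: ew.
have et : expansion (digits (2 * of_digits w)).
  by apply: expansion_digits; have := of_digits_gt0 hw; lia.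
have ht : head 0 (digits (2 * of_digits w)) != 0 by case/andP: et.
by apply/idP/idP => es;
  [have [] := expansion_subst es hw et|have [] := expansion_subst es ht ew].
Qed.

Lemma str_equiv_expansion x y : x ~ y -> expansion x = expansion y.
Proof. by elim=> [a b /double_step_expansion| |a b _ ->|a b c _ -> _ ->]. Qed.

Lemma double_step_reachable x y (a b : posint) : double_step x y ->
  expansion x -> val a = of_digits x -> val b = of_digits y ->
  reachable choix_graph a b.
Proof.
move=> [u [w [v [xE yE ew]]]] ex ax bx.
(* Edges join distinct vertices only, so equality is split off. *)
have [->|ab] := pselect (a = b); first exact: rt_refl.
apply: rt_step; split=> //; apply/choix_splitP; first exact: valP.
right; exists u, w, v; split; last by left; rewrite bx yE.
  by rewrite ax of_digitsK.
by case/andP: ew.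
Qed.

Lemma str_equiv_reachable x y (a b : posint) : x ~ y ->
  expansion x -> val a = of_digits x -> val b = of_digits y ->
  reachable choix_graph a b.
Proof.
(* The vertices are generalized because transitivity passes through a new one, built from the middle
   string. *)
move=> xy; elim: xy a b =>
  [{}x {}y xy|{}x|{}x {}y xy IH|{}x z {}y xz IH1 zy IH2] a b ex ax bx.
- exact: double_step_reachable xy ex ax bx.
- suff -> : a = b by exact: rt_refl.
  by apply: val_inj; rewrite ax bx.
- apply/reachable_sym/IH => //.
  by rewrite (str_equiv_expansion xy).
have ez : expansion z by rewrite -(str_equiv_expansion xz).
have z0 : 0 < of_digits z by apply: of_digits_gt0; case/andP: ez.
pose c : posint := exist (fun n => 0 < n) (of_digits z) z0.
by apply: (reachable_trans (y := c)); [exact: IH1|exact: IH2].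
Qed.

Definition pos1 : posint := exist (fun n => 0 < n) 1 isT.
Definition pos10 : posint := exist (fun n => 0 < n) 10 isT.

Lemma reachable_pos1_or_pos10 a :
  reachable choix_graph a (if ends_in_0_or_5 a then pos10 else pos1).
Proof.
have ea := expansion_digits (valP a).
have aE : val a = of_digits (digits (val a)) by rewrite digitsK.
case: (expansion_equiv ea) => e.
  have r := @str_equiv_reachable _ _ a pos1 e ea aE erefl.
  (* Invariance along the path [r] shows that its endpoint is the one the conditional selects. *)
  by rewrite (reachable_ends_in_0_or_5 r).
have r := @str_equiv_reachable _ _ a pos10 e ea aE erefl.
by rewrite (reachable_ends_in_0_or_5 r).
Qed.

Lemma reachable_choixP a b :
  reachable choix_graph a b <-> ends_in_0_or_5 a = ends_in_0_or_5 b.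
Proof.
split; first exact: reachable_ends_in_0_or_5.
move=> ab; apply: reachable_trans (reachable_pos1_or_pos10 a) _.
by rewrite ab; apply/reachable_sym/reachable_pos1_or_pos10.
Qed.

Theorem theorem4 :
  let A : set posint := [set n | ~~ ends_in_0_or_5 n] in
  let B : set posint := [set n | ends_in_0_or_5 n] in
  components choix_graph = [set A; B] /\ A <> B.
Proof.
move=> A B.
have cA a : ~~ ends_in_0_or_5 a -> A = [set y | reachable choix_graph a y].
  move=> /negbTE ha; apply/seteqP; split=> y /=; rewrite reachable_choixP ha.
    by move/negbTE.
  by rewrite /A /= => <-.
have cB a : ends_in_0_or_5 a -> B = [set y | reachable choix_graph a y].
  by move=> ha; apply/seteqP; split=> y /=; rewrite reachable_choixP ha.
(* [pos1] belongs to [A] but not to [B]. *)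
split; last by move/seteqP => [/(_ pos1 isT)].
apply/seteqP; split=> C /=.
  move=> [a ->]; case: (boolP (ends_in_0_or_5 a)) => [/cB <-|/cA <-].
    by right.
  by left.
by case=> ->; [exists pos1; exact: cA|exists pos10; exact: cB].
Qed.
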